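(* Let $\mathbb F$ be a field of characteristic not $2$, let $N\in\mathbb N$, and let $V$ be a vector space over $\mathbb F$ with dimension $N+1$. Let $B$ be a Billiard Array on $V$. Assume that each white 3-clique in $\Delta_N$ has $B$-value $1$. Then there exists a unique $\mathfrak{sl}_2$-module structure on $V$ such that for $0\le i\le N$, $x-(2i-N)I$ (resp. $y-(2i-N)I$) (resp. $z-(2i-N)I$) vanishes on component $i$ of the $B$-decomposition $[2,3]$ (resp. $[3,1]$) (resp. $[1,2]$) of $V$. The $\mathfrak{sl}_2$-module $V$ is irreducible, provided that the characteristic of $\mathbb F$ is $0$ or greater than $N$.
   Context: $\mathfrak{sl}_2$ denotes the Lie algebra over $\mathbb F$ with basis $x,y,z$ (the equitable basis) and Lie bracket $[x,y]=2x+2y$, $[y,z]=2y+2z$, $[z,x]=2z+2x$. $I$ is the identity map on $V$. $\mathbb N=\{0,1,2,\ldots\}$. $\Delta_n=\{(r,s,t): r,s,t\in\mathbb N,\ r+s+t=n\}$, whose elements are called locations. A line in $\Delta_N$ is a set consisting of all locations whose $\eta$-coordinate equals a fixed number $m$, for some $\eta\in\{1,2,3\}$ and some $0\le m\le N$. Locations $\lambda,\mu$ are adjacent if $\lambda-\mu$ is one of $\pm(1,-1,0),\pm(0,1,-1),\pm(-1,0,1)$. For $N\ge1$, a black 3-clique in $\Delta_N$ is a set $\{(r+1,s,t),(r,s+1,t),(r,s,t+1)\}$ with $(r,s,t)\in\Delta_{N-1}$. Each pair of adjacent locations is contained in a unique black 3-clique. For $N\ge2$, a white 3-clique in $\Delta_N$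 is a set $\{(r,s+1,t+1),(r+1,s,t+1),(r+1,s+1,t)\}$ with $(r,s,t)\in\Delta_{N-2}$; for $N\le1$ there are none. Let $\mathcal P_1(V)$ be the set of one-dimensional subspaces of $V$. A Billiard Array on $V$ is a function $B:\Delta_N\to\mathcal P_1(V)$, $\lambda\mapsto B_\lambda$, such that (i) for each line $L$ in $\Delta_N$ the sum $\sum_{\lambda\in L}B_\lambda$ is direct; (ii) for each black 3-clique $C$ in $\Delta_N$ the sum $\sum_{\lambda\in C}B_\lambda$ is not direct. For adjacent $\lambda,\mu\in\Delta_N$, let $\nu$ be the unique location such that $\lambda,\mu,\nu$ form a black 3-clique. For each nonzero $u\in B_\lambda$ there is a unique nonzero $v\in B_\mu$ with $u+v\in B_\nu$; the $\mathbb F$-linear bijection $\tilde B_{\lambda,\mu}:B_\lambda\to B_\mu$ sends $u\mapsto v$. For a white 3-clique $\lambda=(r,s+1,t+1)$, $\mu=(r+1,s,t+1)$, $\nu=(r+1,s+1,t)$, the composition $\tilde B_{\nu,\lambda}\circ\tilde B_{\mu,\nu}\circ\tilde B_{\lambda,\mu}:B_\lambda\to B_\lambda$ is a nonzero scalar multiple of the identity; this scalar is the $B$-value of the white 3-clique. The $B$-decompositions $[2,3]$, $[3,1]$, $[1,2]$ of $V$ are the sequences of one-dimensional subspaces whose $i$-component ($0\le i\le N$) is $B_{(0,N-i,i)}$, $B_{(i,0,N-i)}$, $B_{(N-i,i,0)}$ respectively; in each case $V$ is the direct sum of the components. *)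

(* Defs.v *)
From HB Require Import structures.
From mathcomp Require Import all_boot all_order all_algebra.
From mathcomp Require Import zify ring.
Set Implicit Arguments.
Unset Strict Implicit.
Unset Printing Implicit Defensive.
Import GRing.Theory.
Local Open Scope ring_scope.

(* The locations r, s, t >= 0, r + s + t = n. *)
Record Delta (n : nat) := Location {
  triple : 'I_n.+1 * 'I_n.+1 * 'I_n.+1;
  _ : (triple.1.1 + triple.1.2 + triple.2 == n)%N }.

HB.instance Definition _ n := [isSub for @triple n].
HB.instance Definition _ n := [Finite of Delta n by <:].

Definition coords n (l : Delta n) : nat * nat * nat :=
  (nat_of_ord (triple l).1.1, nat_of_ord (triple l).1.2,
   nat_of_ord (triple l).2).

Lemma coords_inj n : injective (@coords n).
Proof.
move=> l l'; case El: (triple l) => [[a b] c]; case El': (triple l') => [[a' b'] c'].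
rewrite /coords El El' /= => -[/val_inj Ea /val_inj Eb /val_inj Ec].
by apply: val_inj; rewrite /= El El' Ea Eb Ec.
Qed.

Lemma coords_eq n (l l' : Delta n) : (l == l') = (coords l == coords l').
Proof. by rewrite (inj_eq (@coords_inj n)). Qed.

Lemma coords_sum n (l : Delta n) :
  ((coords l).1.1 + (coords l).1.2 + (coords l).2)%N = n.
Proof. by case: l => p /= /eqP. Qed.

Section Loc.
Variables (n r s t : nat) (h : (r + s + t = n)%N).

Fact loc_lt1 : (r < n.+1)%N.
Proof. by rewrite -h ltnS -addnA leq_addr. Qed.
Fact loc_lt2 : (s < n.+1)%N.
Proof. by rewrite -h ltnS -addnA addnCA leq_addr. Qed.
Fact loc_lt3 : (t < n.+1)%N.
Proof. by rewrite -h ltnS leq_addl. Qed.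
Fact loc_sum : (r + s + t == n)%N.
Proof. exact/eqP. Qed.

Definition loc : Delta n :=
  @Location n (Ordinal loc_lt1, Ordinal loc_lt2, Ordinal loc_lt3) loc_sum.

Lemma coords_loc : coords loc = (r, s, t).
Proof. by []. Qed.
End Loc.

Definition is_line n (L : {set Delta n}) : Prop :=
  exists m : nat, (m <= n)%N /\
    [\/ L = [set l | (coords l).1.1 == m],
        L = [set l | (coords l).1.2 == m] |
        L = [set l | (coords l).2 == m]].

Definition black_clique n (C : {set Delta n}) : Prop :=
  exists r s t : nat, (r + s + t).+1 = n /\
    C = [set l | coords l \in [:: (r.+1, s, t); (r, s.+1, t); (r, s, t.+1)]].

(* The vertices are listed in the cyclic order used for the B-value. *)
Definition white_clique n (la mu nu : Delta n) : Prop :=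
  exists r s t : nat, [/\ coords la = (r, s.+1, t.+1),
    coords mu = (r.+1, s, t.+1) & coords nu = (r.+1, s.+1, t)].

Section BilliardArray.
Variables (F : fieldType) (V : vectType F) (N : nat).
Implicit Types (B : Delta N -> {vspace V}) (la mu nu : Delta N).

Definition billiard_array B : Prop :=
  [/\ forall l, \dim (B l) = 1%N,
      forall L, is_line L -> directv (\sum_(l in L) B l)%VS &
      forall C, black_clique C -> ~~ directv (\sum_(l in C) B l)%VS].

(* f is the map B~_{la,mu}; see Btilde_exists_unique. *)
Definition is_Btilde B la mu
    (f : 'Hom(subvs_of (B la), subvs_of (B mu))) : Prop :=
  exists nu, black_clique [set la; mu; nu] /\
    forall u, u != 0 -> f u != 0 /\ vsval u + vsval (f u) \in B nu.

(* a is the B-value of the white 3-clique; see Bvalue_exists_unique. *)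
Definition is_Bvalue B la mu nu (a : F) : Prop :=
  exists (f : 'Hom(subvs_of (B la), subvs_of (B mu)))
         (g : 'Hom(subvs_of (B mu), subvs_of (B nu)))
         (h : 'Hom(subvs_of (B nu), subvs_of (B la))),
    [/\ is_Btilde f, is_Btilde g, is_Btilde h
      & (h \o g \o f)%VF = a *: \1%VF].

Lemma card_set3 (T : finType) (a b c : T) :
  uniq [:: a; b; c] -> #|[set a; b; c]| = 3%N.
Proof.
rewrite /= !inE negb_or => /and3P[/andP[ab ac] bc _].
by rewrite -setUA cardsU1 cards2 !inE bc (negbTE ab) (negbTE ac).
Qed.

Lemma black_clique_card (C : {set Delta N}) : black_clique C -> #|C| = 3%N.
Proof.
move=> [r [s [t [E ->]]]].
have h1 : (r.+1 + s + t = N)%N by lia.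
have h2 : (r + s.+1 + t = N)%N by lia.
have h3 : (r + s + t.+1 = N)%N by lia.
have -> : [set l : Delta N |
    coords l \in [:: (r.+1, s, t); (r, s.+1, t); (r, s, t.+1)]]
    = [set loc h1; loc h2; loc h3].
  by apply/setP=> l; rewrite !inE !coords_eq !coords_loc orbA.
have u : uniq [:: loc h1; loc h2; loc h3].
  rewrite /= !in_cons !in_nil !orbF !coords_eq !coords_loc !xpair_eqE.
  have n1 k : (k.+1 == k) = false by rewrite gtn_eqF.
  have n2 k : (k == k.+1) = false by rewrite ltn_eqF.
  by rewrite !n1 !n2 /= ?andbF.
exact: card_set3.
Qed.

Lemma black_clique_neq la mu nu : black_clique [set la; mu; nu] ->
  [/\ la != mu, mu != nu & nu != la].
Proof.
move=> /black_clique_card E; split; apply/eqP=> H; move: E; rewrite H.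
- by rewrite setUid cards2; case: eqP.
- by rewrite -setUA setUid cards2; case: eqP.
- by rewrite setUAC setUid cards2; case: eqP.
Qed.

Lemma black_clique_rot la mu nu :
  black_clique [set la; mu; nu] -> black_clique [set mu; nu; la].
Proof. by rewrite -setUA setUC. Qed.

Lemma black_clique_inj la mu nu nu' :
  black_clique [set la; mu; nu] -> black_clique [set la; mu; nu'] -> nu = nu'.
Proof.
move=> b b'.
have [nlm nmn nnl] := black_clique_neq b.
have: [set la; mu; nu] = [set la; mu; nu'].
  have: la \in [set la; mu; nu] by rewrite !inE eqxx.
  have: la \in [set la; mu; nu'] by rewrite !inE eqxx.
  have: mu \in [set la; mu; nu] by rewrite !inE eqxx orbT.
  have: mu \in [set la; mu; nu'] by rewrite !inE eqxx orbT.
  case: b => [r [s [t [E ->]]]]; case: b' => [r' [s' [t' [E' ->]]]].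
  move: nlm; rewrite coords_eq !inE.
  case: (coords la) => [[a1 a2] a3]; case: (coords mu) => [[b1 b2] b3].
  rewrite !xpair_eqE => H1 H2 H3 H4 H5.
  have [-> [-> ->]] // : r = r' /\ s = s' /\ t = t' by lia.
move/setP/(_ nu); rewrite !inE eqxx orbT (negbTE nnl).
by rewrite eq_sym (negbTE nmn) => /esym/eqP.
Qed.

Lemma billiard_cap B (C : {set Delta N}) la mu : billiard_array B ->
  black_clique C -> la \in C -> mu \in C -> la != mu ->
  (B la :&: B mu)%VS = 0%VS.
Proof.
move=> [_ Bl _] [r [s [t [E ->]]]] hla hmu nlm.
have [L [Ll lL mL]] : exists L : {set Delta N},
    [/\ is_line L, la \in L & mu \in L].
  have: [|| (coords la).1.1 == (coords mu).1.1,
            (coords la).1.2 == (coords mu).1.2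
          | (coords la).2 == (coords mu).2].
    move: hla hmu; rewrite !inE; case: (coords la) => [[a1 a2] a3].
    by case: (coords mu) => [[b1 b2] b3]; rewrite !xpair_eqE /=; lia.
  have S := coords_sum la.
  case/or3P=> /eqP e.
  - exists [set l : Delta N | (coords l).1.1 == (coords la).1.1].
    rewrite !inE e eqxx; split=> //; exists (coords la).1.1.
    by rewrite -e; split; [lia | constructor 1].
  - exists [set l : Delta N | (coords l).1.2 == (coords la).1.2].
    rewrite !inE e eqxx; split=> //; exists (coords la).1.2.
    by rewrite -e; split; [lia | constructor 2].
  - exists [set l : Delta N | (coords l).2 == (coords la).2].
    rewrite !inE e eqxx; split=> //; exists (coords la).2.
    by rewrite -e; split; [lia | constructor 3].
have /directv_sumP/(_ la lL) H := Bl L Ll.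
apply/eqP; rewrite -subv0 -H; apply: capvS => //.
by apply: (sumv_sup mu) => //; rewrite mL eq_sym.
Qed.

Lemma billiard_cap3 B la mu nu : billiard_array B ->
  black_clique [set la; mu; nu] ->
  [/\ (B la :&: B mu)%VS = 0%VS, (B mu :&: B nu)%VS = 0%VS &
      (B nu :&: B la)%VS = 0%VS].
Proof.
move=> hB b; have [n1 n2 n3] := black_clique_neq b.
by split; apply: (billiard_cap hB b) => //; rewrite !inE eqxx ?orbT.
Qed.

Lemma billiard_sub B la mu nu : billiard_array B ->
  black_clique [set la; mu; nu] -> (B la <= B mu + B nu)%VS.
Proof.
move=> hB b; have [n1 n2 n3] := black_clique_neq b.
have [_ c2 _] := billiard_cap3 hB b.
case: hB => d1 _ /(_ _ b) nd.
have [c|nc] := eqVneq (B la :&: (B mu + B nu))%VS 0%VS; last first.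
  apply/capv_idPl/eqP; rewrite eqEdim capvSl d1 lt0n.
  by rewrite dimv_eq0.
have la0 : la \notin [set mu; nu] by rewrite !inE negb_or n1 eq_sym.
have mu0 : mu \notin [set nu] by rewrite inE.
case/negP: nd; rewrite directvE /= -setUA !big_setU1 //= !big_set1.
by rewrite !dimv_disjoint_sum ?d1.
Qed.

Lemma Btilde_exists_unique B la mu nu : billiard_array B ->
  black_clique [set la; mu; nu] ->
  exists! f : 'Hom(subvs_of (B la), subvs_of (B mu)), is_Btilde f.
Proof.
move=> hB b; have [c1 c2 c3] := billiard_cap3 hB b.
have sub := billiard_sub hB b.
pose pi : 'Hom(subvs_of (B la), subvs_of (B mu)) :=
  (linfun (vsproj (B mu)) \o - daddv_pi (B mu) (B nu) \o linfun vsval)%VF.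
have piE u : vsval (pi u) = - daddv_pi (B mu) (B nu) (vsval u).
  rewrite !comp_lfunE opp_lfunE !lfunE /= vsprojK // memvN.
  exact: memv_pi.
exists pi; split.
  exists nu; split=> // u u0.
  have Eu : vsval u + vsval (pi u) = daddv_pi (B nu) (B mu) (vsval u).
    have E := daddv_pi_add c2 (subvP sub _ (subvsP u)).
    by rewrite piE -{1}E addrAC subrr add0r.
  have mem : vsval u + vsval (pi u) \in B nu by rewrite Eu memv_pi.
  split=> //; apply: contra u0 => /eqP p0.
  move: mem; rewrite p0 linear0 addr0 => un.
  rewrite -(inj_eq (@subvs_inj _ _ _)) linear0 -memv0 -c3 memv_cap un.
  exact: subvsP.
move=> f [nu' [b' hf]].
have {b'} En := black_clique_inj b' b; subst nu'.
apply/lfunP=> u; have [->|u0] := eqVneq u 0; first by rewrite !linear0.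
have [_ fn] := hf _ u0.
apply: subvs_inj; apply/eqP; rewrite -subr_eq0 -memv0 -c2 memv_cap.
rewrite memvB ?subvsP //=.
have -> : vsval (pi u) - vsval (f u)
   = (vsval u + vsval (pi u)) - (vsval u + vsval (f u)).
  by rewrite opprD addrACA subrr add0r.
rewrite memvB // piE.
have E := daddv_pi_add c2 (subvP sub _ (subvsP u)).
by rewrite -{1}E addrAC subrr add0r memv_pi.
Qed.

Lemma black_cliqueP (r s t : nat) la mu nu : uniq [:: la; mu; nu] ->
  {subset [:: coords la; coords mu; coords nu]
     <= [:: (r.+1, s, t); (r, s.+1, t); (r, s, t.+1)]} ->
  black_clique [set la; mu; nu].
Proof.
move=> u sub.
have h : (r + s + t).+1 = N.
  have := sub (coords la) (mem_head _ _); have := coords_sum la.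
  by rewrite !inE; case: (coords la) => [[a1 a2] a3]; rewrite !xpair_eqE /=; lia.
have b : black_clique [set l : Delta N |
    coords l \in [:: (r.+1, s, t); (r, s.+1, t); (r, s, t.+1)]].
  by exists r, s, t.
exists r, s, t; split=> //; apply/eqP; rewrite eqEcard.
rewrite (black_clique_card b); apply/andP; split.
  apply/subsetP=> l hl.
  have : coords l \in [:: coords la; coords mu; coords nu].
    by move: hl; rewrite !inE => /orP[/orP[]|] /eqP ->; rewrite eqxx ?orbT.
  by move/sub; rewrite !inE.
by rewrite card_set3.
Qed.

Lemma white_clique_rot_black la mu nu : white_clique la mu nu ->
  [/\ exists k, black_clique [set la; mu; k],
      exists k, black_clique [set mu; nu; k] &
      exists k, black_clique [set nu; la; k]].
Proof.
move=> [r [s [t [E1 E2 E3]]]].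
have S : (r + s + t).+2 = N by have := coords_sum la; rewrite E1 /=; lia.
have h1 : (r + s + t.+2 = N)%N by lia.
have h2 : (r.+2 + s + t = N)%N by lia.
have h3 : (r + s.+2 + t = N)%N by lia.
split; [exists (loc h1); apply: (@black_cliqueP r s t.+1)
  | exists (loc h2); apply: (@black_cliqueP r.+1 s t)
  | exists (loc h3); apply: (@black_cliqueP r s.+1 t)].
all: rewrite ?E1 ?E2 ?E3 ?coords_loc.
all: try by rewrite /= !inE !coords_eq ?E1 ?E2 ?E3 ?coords_loc
  !xpair_eqE; lia.
all: by move=> x; rewrite !inE => /or3P[] /eqP ->; rewrite eqxx ?orbT.
Qed.

Lemma Bvalue_exists_unique B la mu nu : billiard_array B ->
  white_clique la mu nu -> exists! a : F, is_Bvalue B la mu nu a.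
Proof.
move=> hB w; have [[k1 b1] [k2 b2] [k3 b3]] := white_clique_rot_black w.
have [f [hf uf]] := Btilde_exists_unique hB b1.
have [g [hg ug]] := Btilde_exists_unique hB b2.
have [h [hh uh]] := Btilde_exists_unique hB b3.
have d1 : \dim (fullv : {vspace subvs_of (B la)}) = 1%N.
  by rewrite dimvf; case: hB => /(_ la).
have [u u0 Eu] : exists2 u : subvs_of (B la), u != 0 & fullv = <[u]>%VS.
  exists (vpick fullv); first by rewrite vpick0 -dimv_eq0 d1.
  apply/esym/eqP; rewrite eqEdim subvf d1 dim_vline vpick0 -dimv_eq0 d1.
  by [].
have /vlineP[a Ea] : (h \o g \o f)%VF u \in <[u]>%VS by rewrite -Eu memvf.
exists a; split.
  exists f, g, h; split=> //; apply/lfunP=> v.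
  have /vlineP[c ->] : v \in <[u]>%VS by rewrite -Eu memvf.
  by rewrite linearZ /= Ea scale_lfunE id_lfunE /= !scalerA mulrC.
move=> a' [f' [g' [h' [hf' hg' hh' E]]]].
move: E; rewrite -(uf _ hf') -(ug _ hg') -(uh _ hh') => /lfunP/(_ u).
rewrite Ea scale_lfunE id_lfunE => /eqP; rewrite -subr_eq0 -scalerBl.
by rewrite scaler_eq0 (negbTE u0) orbF subr_eq0 => /eqP.
Qed.

Fact decomp23_proof (i : 'I_N.+1) : (0 + (N - i) + i = N)%N.
Proof. by rewrite add0n subnK // -ltnS. Qed.
Fact decomp31_proof (i : 'I_N.+1) : (i + 0 + (N - i) = N)%N.
Proof. by rewrite addn0 subnKC // -ltnS. Qed.
Fact decomp12_proof (i : 'I_N.+1) : (N - i + i + 0 = N)%N.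
Proof. by rewrite addn0 subnK // -ltnS. Qed.

Definition decomp23 B (i : 'I_N.+1) := B (loc (decomp23_proof i)).
Definition decomp31 B (i : 'I_N.+1) := B (loc (decomp31_proof i)).
Definition decomp12 B (i : 'I_N.+1) := B (loc (decomp12_proof i)).

End BilliardArray.

Section Sl2.
Variable F : fieldType.

Definition sl2 : vectType F := 'rV[F]_3.

Definition sl2x : sl2 := delta_mx 0 0.
Definition sl2y : sl2 := delta_mx 0 1.
Definition sl2z : sl2 := delta_mx 0 2.

(* The bilinear alternating extension of
   [x,y] = 2x + 2y, [y,z] = 2y + 2z, [z,x] = 2z + 2x. *)
Definition sl2_bracket (a b : sl2) : sl2 :=
  let a_ (i : 'I_3) : F := (a : 'rV_3) 0 i in
  let b_ (i : 'I_3) : F := (b : 'rV_3) 0 i in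
  (a_ 0 * b_ 1 - a_ 1 * b_ 0) *: (2%:R *: sl2x + 2%:R *: sl2y)
  + (a_ 1 * b_ 2 - a_ 2 * b_ 1) *: (2%:R *: sl2y + 2%:R *: sl2z)
  + (a_ 2 * b_ 0 - a_ 0 * b_ 2) *: (2%:R *: sl2z + 2%:R *: sl2x).

Lemma sl2_bracketxy : sl2_bracket sl2x sl2y = 2%:R *: sl2x + 2%:R *: sl2y.
Proof. by apply/rowP=> j; rewrite !mxE /=; ring. Qed.

Lemma sl2_bracketyz : sl2_bracket sl2y sl2z = 2%:R *: sl2y + 2%:R *: sl2z.
Proof. by apply/rowP=> j; rewrite !mxE /=; ring. Qed.

Lemma sl2_bracketzx : sl2_bracket sl2z sl2x = 2%:R *: sl2z + 2%:R *: sl2x.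
Proof. by apply/rowP=> j; rewrite !mxE /=; ring. Qed.

Lemma sl2_bracketDZ (k : F) (a b c : sl2) :
  sl2_bracket (k *: a + b) c = k *: sl2_bracket a c + sl2_bracket b c.
Proof. by apply/rowP=> j; rewrite !mxE /=; ring. Qed.

Lemma sl2_bracketaa (a : sl2) : sl2_bracket a a = 0.
Proof. by apply/rowP=> j; rewrite !mxE /=; ring. Qed.

Lemma sl2_bracketC (a b : sl2) : sl2_bracket a b = - sl2_bracket b a.
Proof. by apply/rowP=> j; rewrite !mxE /=; ring. Qed.

Lemma sl2_jacobi (a b c : sl2) :
  sl2_bracket a (sl2_bracket b c) + sl2_bracket b (sl2_bracket c a)
  + sl2_bracket c (sl2_bracket a b) = 0.
Proof. by apply/rowP=> j; rewrite !mxE /=; ring. Qed.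

Variable V : vectType F.

(* An sl2-module structure on V, as a representation of sl2 in End(V). *)
Definition is_sl2_module (rho : 'Hom(sl2, 'End(V))) : Prop :=
  forall a b : sl2,
    rho (sl2_bracket a b) = ((rho a \o rho b)%VF - (rho b \o rho a)%VF).

Definition sl2_irreducible (rho : 'Hom(sl2, 'End(V))) : Prop :=
  (fullv : {vspace V}) <> 0%VS /\
  forall W : {vspace V}, (forall a : sl2, (rho a @: W <= W)%VS) ->
    W = 0%VS \/ W = fullv.

End Sl2.

Section Compatible.
Variables (F : fieldType) (V : vectType F) (N : nat) (B : Delta N -> {vspace V}).

Definition is_compatible (rho : 'Hom(sl2 F, 'End(V))) : Prop :=
  forall i : 'I_N.+1,
    [/\ forall v, v \in decomp23 B i ->
          (rho (sl2x F) - ((2 * i)%N%:R - N%:R) *: \1)%VF v = 0,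
        forall v, v \in decomp31 B i ->
          (rho (sl2y F) - ((2 * i)%N%:R - N%:R) *: \1)%VF v = 0
      & forall v, v \in decomp12 B i ->
          (rho (sl2z F) - ((2 * i)%N%:R - N%:R) *: \1)%VF v = 0].

End Compatible.

(* Main.v *)
From HB Require Import structures.
Require Import Defs.
From mathcomp Require Import all_boot all_order all_algebra.
From mathcomp Require Import zify ring.
Set Implicit Arguments.
Unset Strict Implicit.
Unset Printing Implicit Defensive.
Import GRing.Theory.
Local Open Scope ring_scope.

(** The model behind the theorem is the degree N part of
    F[x, y, z] / (x + y + z), in which the location (r, s, t) carries the line
    spanned by the monomial x^r y^s z^t.  Multiplying x + y + z = 0 by a monomial
    of degree N - 1 says that the three monomials of a black 3-clique add up to
    zero.  The space of linear forms is a two-dimensional sl2-module, and sl2 acts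
    on the quotient ring by derivations.

    A Billiard Array with all B-values 1 is of this form.  The maps B~ form a
    flat connection: going round a black 3-clique is always trivial, and going
    round a white 3-clique is trivial by hypothesis.  Hence vectors chosen along
    one edge of the triangle by transport extend row by row, the new
    vector of each black 3-clique being minus the sum of the two others
    ([propagate_mem]).  This yields nonzero vectors w r s t in B (r, s, t)
    subject to w (r+1) s t + w r (s+1) t + w r s (t+1) = 0 ([frame_exists]).

    Each of the three boundary edges gives a basis of V ([line_basis]), so
    compatibility prescribes x, y and z as diagonal operators on these three
    bases; this gives uniqueness.  For existence it remains to check the bracket
    relations.  The operator x, diagonal on the edge r = 0, acts on every w r s t
    like the derivation x |-> y - z, y |-> -y, z |-> z
    ([edge_diagonal_action]); the same formula, with the coordinates rotated,
    holds for y and z.  Consequently y and z are explicit bidiagonal matrices on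
    the edge r = 0 ([raise_edge], [lower_edge]) and the bracket of x and y is
    computed there ([equitable_bracket]); the other two brackets follow by
    rotating the coordinates.

    On the edge r = 0 the operators x + y and x + z move one step in
    opposite directions, with coefficients 2s and -2t.  Inside the edge s and t
    lie between 1 and N, so these coefficients are nonzero when the
    characteristic is not 2 and is 0 or exceeds N; then an invariant subspace is
    0 or V ([ladder_irreducible]). *)

(** * Flatness: vectors that add up to zero on black cliques *)

Section Frame.
Variables (F : fieldType) (V : vectType F) (N : nat).
Variable B : Delta N -> {vspace V}.
Hypothesis hB : billiard_array B.
Implicit Types (la mu nu k : Delta N).

Lemma loc_exists r s t :
  (r + s + t = N)%N -> exists l : Delta N, coords l = (r, s, t).
Proof. by move=> h; exists (loc h); apply: coords_loc. Qed.

Lemma black_clique_coords r s t la mu nu :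
  coords la = (r.+1, s, t) -> coords mu = (r, s.+1, t) ->
  coords nu = (r, s, t.+1) -> black_clique [set la; mu; nu].
Proof.
move=> E1 E2 E3; apply: (@black_cliqueP _ r s t).
  by rewrite /= !inE !coords_eq E1 E2 E3 !xpair_eqE; lia.
by move=> p; rewrite E1 E2 E3.
Qed.

Lemma black_clique_swap la mu nu :
  black_clique [set la; mu; nu] -> black_clique [set mu; la; nu].
Proof. by rewrite (setUC [set la]). Qed.

Lemma cap0_eq0 la mu (v : V) :
  (B la :&: B mu)%VS = 0%VS -> v \in B la -> v \in B mu -> v = 0.
Proof.
by move=> E h1 h2; apply/eqP; rewrite -memv0 -E memv_cap h1.
Qed.

(** The map B~ from [B la] to [B mu] is treated as the relation u + v \in B nu
    between vectors of V, so that vectors obtained along different paths can be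
    compared without casts between subspace types. *)
Lemma transport_unique la mu nu u v v' :
  black_clique [set la; mu; nu] -> v \in B mu -> v' \in B mu ->
  u + v \in B nu -> u + v' \in B nu -> v = v'.
Proof.
move=> b hv hv' h h'; have [_ c _] := billiard_cap3 hB b.
apply/eqP; rewrite -subr_eq0; apply/eqP/(cap0_eq0 c); first exact: memvB.
have -> : v - v' = (u + v) - (u + v') by rewrite opprD addrACA subrr add0r.
exact: memvB.
Qed.

Lemma transport_exists la mu nu u :
  black_clique [set la; mu; nu] -> u \in B la -> u != 0 ->
  exists v, [/\ v \in B mu, v != 0 & u + v \in B nu].
Proof.
move=> b hu u0; have [_ _ c] := billiard_cap3 hB b.
have /memv_addP[p hp [q hq E]] := subvP (billiard_sub hB b) _ hu.
exists (- p); rewrite memvN hp oppr_eq0; split=> //.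
  apply: contra u0 => /eqP p0; apply/eqP/(cap0_eq0 c) => //.
  by rewrite E p0 add0r.
by rewrite E addrAC subrr add0r.
Qed.

(** A B-value 1 means that transport around the white clique closes up: [u] goes
    to [v], then to [w], then back to the same [u]. *)
Lemma white_transport la mu nu k1 k2 k3 u :
  is_Bvalue B la mu nu 1 ->
  black_clique [set la; mu; k1] -> black_clique [set mu; nu; k2] ->
  black_clique [set nu; la; k3] -> u \in B la -> u != 0 ->
  exists v w, [/\ v \in B mu, w \in B nu, u + v \in B k1, v + w \in B k2
                & w + u \in B k3].
Proof.
move=> [f [g [h [[m1 [c1 hf]] [m2 [c2 hg]] [m3 [c3 hh]] E]]]] b1 b2 b3 hu u0.
rewrite -(black_clique_inj c1 b1) -(black_clique_inj c2 b2).
rewrite -(black_clique_inj c3 b3).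
pose u' := Subvs hu.
have u'0 : u' != 0 by apply: contra u0 => /eqP/(congr1 vsval)/= ->.
have [f0 fB] := hf _ u'0; have [g0 gB] := hg _ f0; have [_ hhB] := hh _ g0.
move/lfunP/(_ u'): E; rewrite !comp_lfunE scale1r id_lfunE => E.
exists (vsval (f u')), (vsval (g (f u'))).
by split; rewrite ?subvsP // -[u]/(vsval u') -{2}E.
Qed.

(** The value at (r, s, t) of the family with values [a s] on the edge t = 0 and
    zero sum on black cliques; it does not depend on r. *)
Fixpoint propagate (a : nat -> V) s t :=
  if t is t'.+1 then - propagate a s t' - propagate a s.+1 t' else a s.

Hypothesis hw : forall la mu nu, white_clique la mu nu ->
  is_Bvalue B la mu nu 1.

(** Induction on the row t.  Row t + 1 lies in B because two neighbours of row t
    have their sum in the line that completes their black clique, and this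
    property must itself be carried to row t + 1.  Two neighbours of row t + 1
    form a white clique with a vector of row t; as each of them is related to
    that vector by transport across a black clique, the B-value 1 makes them
    transports of each other. *)
Lemma propagate_mem (a : nat -> V) :
  (forall r s l, coords l = (r, s, 0%N) -> a s \in B l /\ a s != 0) ->
  (forall r s l, coords l = (r, s, 1%N) -> a s + a s.+1 \in B l) ->
  forall t r s l, coords l = (r, s, t) ->
    propagate a s t \in B l /\ propagate a s t != 0.
Proof.
move=> ha0 ha1 t.
suff [] : (forall r s l, coords l = (r, s, t) ->
     propagate a s t \in B l /\ propagate a s t != 0) /\
   (forall r s l, coords l = (r, s, t.+1) ->
     propagate a s t + propagate a s.+1 t \in B l) by [].
elim: t => [//|t [IH1 IH2]].
have H1 r s l : coords l = (r, s, t.+1) ->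
    propagate a s t.+1 \in B l /\ propagate a s t.+1 != 0.
  move=> El; have S := coords_sum l; rewrite El /= in S.
  have [l1 E1] := @loc_exists r.+1 s t ltac:(lia).
  have [l2 E2] := @loc_exists r s.+1 t ltac:(lia).
  have [c _ _] := billiard_cap3 hB (black_clique_coords E1 E2 El).
  have [m1 n1] := IH1 _ _ _ E1; have [m2 _] := IH1 _ _ _ E2.
  rewrite /= -opprD memvN oppr_eq0 (IH2 _ _ _ El); split=> //.
  apply: contra n1; rewrite addr_eq0 => /eqP e.
  by apply/eqP/(cap0_eq0 c) => //; rewrite e memvN.
split=> // r s k1 E1; have S := coords_sum k1; rewrite E1 /= in S.
have [la Ela] := @loc_exists r s.+1 t.+1 ltac:(lia).
have [mu Emu] := @loc_exists r.+1 s t.+1 ltac:(lia).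
have [nu Enu] := @loc_exists r.+1 s.+1 t ltac:(lia).
have [k2 E2] := @loc_exists r.+2 s t ltac:(lia).
have [k3 E3] := @loc_exists r s.+2 t ltac:(lia).
have W : white_clique la mu nu by exists r, s, t.
have b1 : black_clique [set la; mu; k1].
  exact/black_clique_swap/(black_clique_coords Emu Ela E1).
have b2 : black_clique [set mu; nu; k2].
  exact/black_clique_swap/black_clique_rot/(black_clique_coords E2 Enu Emu).
have b3 : black_clique [set nu; la; k3].
  exact/black_clique_swap/black_clique_rot/black_clique_rot/
    (black_clique_coords Enu E3 Ela).
have [mla nla] := H1 _ _ _ Ela; have [mmu _] := H1 _ _ _ Emu.
have [mnu _] := IH1 _ _ _ Enu.
(* The vectors given by transport around the white clique are the propagated
   ones, by uniqueness in the black cliques through k3 and k2. *)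
have [v [w [hv hw' h1 h2 h3]]] := white_transport (hw W) b1 b2 b3 mla nla.
have Ew : w = propagate a s.+1 t.
  apply: (transport_unique (black_clique_swap b3) hw' mnu).
    by rewrite addrC; apply: h3.
  by rewrite /= addrAC addNr add0r memvN; case: (IH1 _ _ _ E3).
have Ev : v = propagate a s t.+1.
  apply: (transport_unique (black_clique_swap b2) hv mmu).
    by rewrite addrC; apply: h2.
  rewrite Ew /= addrCA subrr addr0 memvN.
  by case: (IH1 _ _ _ E2).
by rewrite addrC -Ev.
Qed.

(** Transport along the edge t = 0, one step at a time. *)
Lemma edge_exists : exists a : nat -> V,
  (forall r s l, coords l = (r, s, 0%N) -> a s \in B l /\ a s != 0) /\
  (forall r s l, coords l = (r, s, 1%N) -> a s + a s.+1 \in B l).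
Proof.
(* [a] is determined up to position n and arbitrary beyond. *)
suff H : forall n, exists a : nat -> V,
  (forall r s l, (s <= n)%N ->
     coords l = (r, s, 0%N) -> a s \in B l /\ a s != 0) /\
  (forall r s l, (s < n)%N ->
     coords l = (r, s, 1%N) -> a s + a s.+1 \in B l).
  have [a [h1 h2]] := H N.
  by exists a; split=> r s l E; [apply: (h1 r) | apply: (h2 r)] => //;
    have := coords_sum l; rewrite E /=; lia.
elim=> [|n [a [h1 h2]]].
  have [l0 E0] := @loc_exists N 0 0 ltac:(lia).
  exists (fun _ => vpick (B l0)); split=> // r s l s0 E.
  have -> : l = l0.
    by apply: coords_inj; rewrite E E0; have := coords_sum l; rewrite E /=;
      move=> <-; congr (_, _, _); lia.
  by rewrite memv_pick vpick0 -dimv_eq0; case: hB => ->.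
have [nN|nN] := ltnP n N; last first.
  exists a; split=> r s l sn E; have := coords_sum l; rewrite E /= => S.
    by apply: (h1 r) => //; lia.
  by apply: (h2 r) => //; lia.
have [la Ela] := @loc_exists (N - n) n 0 ltac:(lia).
have [mu Emu] := @loc_exists (N - n).-1 n.+1 0 ltac:(lia).
have [nu Enu] := @loc_exists (N - n).-1 n 1 ltac:(lia).
have b : black_clique [set la; mu; nu].
  by apply: black_clique_coords Emu Enu; rewrite Ela prednK // subn_gt0.
have [ma na] := h1 _ _ _ (leqnn n) Ela.
have [v [mv nv hv]] := transport_exists b ma na.
exists (fun s => if s == n.+1 then v else a s); split=> r s l sn E.
  have S := coords_sum l; rewrite E /= in S.
  case: eqP => [sE|/eqP sE]; last by apply: (h1 r) => //; lia.
  suff -> : l = mu by [].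
  by apply: coords_inj; rewrite E Emu; congr (_, _, _); lia.
have S := coords_sum l; rewrite E /= in S.
rewrite ltn_eqF // eqSS.
case: eqP => [sE|/eqP sE]; last by apply: (h2 r) => //; lia.
rewrite sE; suff -> : l = nu by [].
by apply: coords_inj; rewrite E Enu; congr (_, _, _); lia.
Qed.

(** The zero-sum relation holds for all indices, even outside the triangle,
    because it is built into [propagate]. *)
Lemma frame_exists : exists w : nat -> nat -> nat -> V,
  (forall r s t, w r.+1 s t + w r s.+1 t + w r s t.+1 = 0) /\
  (forall r s t l, coords l = (r, s, t) -> w r s t \in B l /\ w r s t != 0).
Proof.
have [a [h1 h2]] := edge_exists.
exists (fun _ => propagate a); split=> [r s t|r s t l].
  by rewrite /= -opprD subrr.
exact: (propagate_mem h1 h2).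
Qed.

(** A line through N + 1 locations carries N + 1 = dim V independent vectors. *)
Lemma line_basis (hV : \dim (fullv : {vspace V}) = N.+1) (L : {set Delta N})
    (l : 'I_N.+1 -> Delta N) (e : 'I_N.+1 -> V) :
  is_line L -> injective l -> (forall i, l i \in L) ->
  (forall i, e i \in B (l i) /\ e i != 0) ->
  basis_of fullv [tuple e i | i < N.+1].
Proof.
case: hB => _ hL _ hl li lL he.
rewrite basisEfree subvf size_tuple hV leqnn !andbT.
apply/freeP => k; under eq_bigr do rewrite nth_mktuple.
move=> E i.
(* Independence in a direct sum is indexed by locations, hence the regrouping. *)
pose us la := \sum_(i | l i == la) k i *: e i.
have /directv_sum_independent/(_ us) H := hL L hl.
have E1 : \sum_(la in L) us la = 0.
  by rewrite -[RHS]E [RHS](partition_big l (mem L)) /= => [|j _]; last exact: lL.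
have : us (l i) = 0.
  apply: (H _ E1 _ (lL i)) => la _.
  by apply: memv_suml => j /eqP <-; apply: memvZ; case: (he j).
rewrite /us (big_pred1 i) => [/eqP|j /=]; last by rewrite (inj_eq li).
by rewrite scaler_eq0 (negbTE (proj2 (he i))) orbF => /eqP.
Qed.
End Frame.

(** * Irreducibility from raising and lowering operators *)

Section Ladder.
Variables (F : fieldType) (V : vectType F).

(** Take a nonzero vector of W with top index k; applying R exactly k times
    leaves a nonzero multiple of [f 0], which therefore lies in W, and L then
    produces the other basis vectors. *)
Lemma ladder_irreducible N (f : nat -> V) (R L : 'End(V)) (a b : nat -> F)
    (W : {vspace V}) :
  basis_of fullv [tuple f i | i < N.+1] ->
  R (f 0%N) = 0 ->
  (forall i, (i < N)%N -> R (f i.+1) = a i *: f i /\ a i != 0) ->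
  (forall i, (i < N)%N -> L (f i) = b i *: f i.+1 /\ b i != 0) ->
  (R @: W <= W)%VS -> (L @: W <= W)%VS -> W = 0%VS \/ W = fullv.
Proof.
move=> bf R0 hR hL RW LW.
have fE (i : 'I_N.+1) : [tuple f i | i < N.+1]`_i = f i.
  by rewrite nth_mktuple.
have fr : forall m (d : nat -> F), (m <= N.+1)%N ->
    \sum_(i < m) d i *: f i = 0 -> forall i, (i < m)%N -> d i = 0.
  move=> m d mN; rewrite (big_ord_widen N.+1 (fun i => d i *: f i)) //.
  rewrite big_mkcond => E i im.
  have /freeP/(_ (fun i => if (i < m)%N then d i else 0)) := basis_free bf.
  move=> /(_ _ (Ordinal (leq_trans im mN))); rewrite /= im; apply.
  by rewrite -[RHS]E; apply: eq_bigr => j _; rewrite fE; case: ifP => // _;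
    rewrite scale0r.
have [W0|W0] := eqVneq W 0%VS; [by left | right].
have f0W : f 0%N \in W.
  have top : forall k (c : nat -> F), (k <= N)%N ->
      \sum_(i < k.+1) c i *: f i != 0 -> \sum_(i < k.+1) c i *: f i \in W ->
      f 0%N \in W.
    elim=> [|k IH] c kN.
      rewrite big_ord_recl big_ord0 addr0 /= => n0 /(memvZ (c 0%N)^-1).
      rewrite scalerA mulVf ?scale1r //.
      by apply: contraNneq n0 => ->; rewrite scale0r.
    have [c0|c0] := eqVneq (c k.+1) 0.
      by rewrite big_ord_recr /= c0 scale0r addr0; apply: IH; apply: ltnW.
    move=> _ /(memv_img R)/(subvP RW); rewrite linear_sum.
    under eq_bigr do rewrite linearZ.
    rewrite big_ord_recl /= R0 scaler0 add0r.
    have -> : \sum_(i < k.+1) c (lift ord0 i) *: R (f (lift ord0 i))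
              = \sum_(i < k.+1) (c i.+1 * a i) *: f i.
      apply: eq_bigr => i _; rewrite lift0.
      have [-> _] := hR i (leq_trans (ltn_ord i) kN).
      by rewrite scalerA.
    move=> hW; apply: IH (ltnW kN) _ hW.
    have [_ ak] := hR k kN.
    apply: contra c0 => /eqP /(fr _ (fun i => c i.+1 * a i) (leqW kN)).
    move=> /(_ _ (ltnSn k)) /eqP.
    by rewrite mulf_eq0 (negbTE ak) orbF.
  (* [top] takes coefficients indexed by nat, so those of the basis are
     extended by 0. *)
  pose c i := if insub i is Some j
              then coord [tuple f i | i < N.+1] j (vpick W) else 0.
  have E : \sum_(i < N.+1) c i *: f i = vpick W.
    rewrite [RHS](coord_basis bf (memvf _)); apply: eq_bigr => i _.
    by rewrite fE /c valK.
  by apply: (top N c) => //; rewrite E ?vpick0 ?memv_pick.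
have fW i : (i <= N)%N -> f i \in W.
  elim: i => [//|i IH] iN; have [e b0] := hL i iN.
  have /(memvZ (b i)^-1) := subvP LW _ (memv_img L (IH (ltnW iN))).
  by rewrite e scalerA mulVf // scale1r.
apply/eqP; rewrite eqEsubv subvf -(span_basis bf); apply/span_subvP => v.
by case/tnthP=> i ->; rewrite (tnth_nth 0) fE fW // -ltnS.
Qed.
End Ladder.

(** * Operators diagonal on the edges *)

Lemma eq_coords (F : fieldType) (V : vectType F) (u v : V) :
  (forall i, coord (vbasis fullv) i u = coord (vbasis fullv) i v) -> u = v.
Proof.
move=> h; rewrite (coord_vbasis (memvf u)) (coord_vbasis (memvf v)).
by apply: eq_bigr => i _; rewrite h.
Qed.

(* Identities between linear combinations of vectors reduce, coordinate by
   coordinate, to ring identities in the base field. *)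
Ltac by_coords :=
  apply: eq_coords => ?; rewrite !(linearD, linearN, linearZ, linear0) /=; ring.

Section Equitable.
Variables (F : fieldType) (V : vectType F) (N : nat).
Implicit Types (w : nat -> nat -> nat -> V) (X Y Z : 'End(V)).

Definition balanced w :=
  forall r s t, w r.+1 s t + w r s.+1 t + w r s t.+1 = 0.

Definition edge_basis w :=
  basis_of fullv [tuple w 0%N i (N - i)%N | i < N.+1].

(** The eigenvalue is N - 2s = 2t - N, written so that it remains meaningful as
    the derivation weight of w r s t away from the edge r = 0. *)
Definition edge_diagonal w X := forall s t, (s + t = N)%N ->
  X (w 0%N s t) = (t%:R - s%:R) *: w 0%N s t.

(** Rotating the coordinates carries the edge r = 0, on which x is diagonal, to
    the edge s = 0 of y, and then to the edge t = 0 of z. *)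
Definition rot w := fun r s t => w t r s.

Lemma balanced_rot w : balanced w -> balanced (rot w).
Proof. by move=> h r s t; rewrite /rot -[RHS](h t r s) addrC addrA. Qed.

Lemma balancedS w : balanced w ->
  forall r s t, w r.+1 s t = - w r s.+1 t - w r s t.+1.
Proof.
by move=> hw r s t; apply/eqP; rewrite -opprD -addr_eq0 addrA hw.
Qed.

Lemma edge_ext w X Y : edge_basis w ->
  (forall s t, (s + t = N)%N -> X (w 0%N s t) = Y (w 0%N s t)) -> X = Y.
Proof.
move=> bw h; apply/lfunP => v; rewrite (coord_basis bw (memvf v)) !linear_sum.
apply: eq_bigr => i _; rewrite !linearZ; congr (_ *: _).
rewrite nth_mktuple; apply: h.
by rewrite subnKC // -ltnS.
Qed.

Lemma edge_diagonal_exists w : edge_basis w -> exists X, edge_diagonal w X.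
Proof.
move=> bw; pose g (i : 'I_N.+1) := ((N - i)%:R - i%:R) *: w 0%N i (N - i)%N.
have [f hf] := linear_of_free [tuple w 0%N i (N - i)%N | i < N.+1]
                              [tuple g i | i < N.+1].
exists (linfun f) => s t st; rewrite lfunE.
have sN : (s < N.+1)%N by lia.
have <- : (N - s)%N = t by lia.
have := hf (basis_free bw); rewrite !size_tuple => /(_ erefl).
move/(congr1 (fun x => x`_s)); rewrite (nth_map 0) ?size_tuple //.
by rewrite -[s]/(nat_of_ord (Ordinal sN)) !nth_mktuple.
Qed.

(** The derivation x |-> y - z, y |-> -y, z |-> z applied to x^r y^s z^t.  The
    formula propagates from the edge r = 0 by induction on r, since w (r+1) s t
    is minus the sum of two vectors of index r. *)
Lemma edge_diagonal_action w X : balanced w -> edge_diagonal w X ->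
  forall r s t, (r + s + t = N)%N -> X (w r s t) =
    r%:R *: (w r.-1 s.+1 t - w r.-1 s t.+1) + (t%:R - s%:R) *: w r s t.
Proof.
move=> hw hX.
elim=> [|r IH] s t st; first by rewrite scale0r add0r; apply: hX.
rewrite (balancedS hw) linearB linearN /= !IH; try lia.
case: r IH st => [|r] _ _; rewrite /= ?(balancedS hw r); by_coords.
Qed.

(** The diagonal parts of x and y on the edge cancel. *)
Lemma raise_edge w X Y : balanced w ->
  edge_diagonal w X -> edge_diagonal (rot w) Y ->
  forall s t, (s + t = N)%N ->
    (X + Y)%R (w 0%N s t) = (2 * s)%:R *: w 0%N s.-1 t.+1.
Proof.
move=> hw hX hY s t st; rewrite add_lfunE hX //.
have h := edge_diagonal_action (balanced_rot hw) hY.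
rewrite (h s t 0%N); last lia.
rewrite /rot; case: s st => [|s] st /=; first by by_coords.
rewrite (balancedS hw).
by_coords.
Qed.

Lemma lower_edge w X Z : balanced w ->
  edge_diagonal w X -> edge_diagonal (rot (rot w)) Z ->
  forall s t, (s + t = N)%N ->
    (X + Z)%R (w 0%N s t) = - (2 * t)%:R *: w 0%N s.+1 t.-1.
Proof.
move=> hw hX hZ s t st; rewrite add_lfunE hX //.
have h := edge_diagonal_action (balanced_rot (balanced_rot hw)) hZ.
rewrite (h t 0%N s); last lia.
rewrite /rot; case: t st => [|t] st /=; first by by_coords.
rewrite (balancedS hw).
by_coords.
Qed.

(** This is [x, y] = 2x + 2y, checked on the basis of the edge r = 0, where
    x is diagonal and y is bidiagonal. *)
Lemma equitable_bracket w X Y : balanced w -> edge_basis w ->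
  edge_diagonal w X -> edge_diagonal (rot w) Y ->
  forall v, X (Y v) = Y (X v) + 2%:R *: X v + 2%:R *: Y v.
Proof.
move=> hw bw hX hY v.
suff /lfunP/(_ v) : (X \o Y = (Y \o X) + 2%:R *: X + 2%:R *: Y)%VF.
  by rewrite !(comp_lfunE, add_lfunE, scale_lfunE).
apply: (edge_ext bw) => s t st.
have EY a b : (a + b = N)%N -> Y (w 0%N a b) =
    (2 * a)%:R *: w 0%N a.-1 b.+1 - (b%:R - a%:R) *: w 0%N a b.
  move=> ab; have := raise_edge hw hX hY ab.
  by rewrite add_lfunE hX // addrC => /(canRL (addrK _)).
rewrite !(comp_lfunE, add_lfunE, scale_lfunE) hX // EY //.
(* At s = 0 the term with s.-1 leaves the triangle, but its coefficient is 0. *)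
case: s st => [|s] st /=.
  rewrite muln0 !scale0r !sub0r !(linearN, linearZ) /= hX // EY //; by_coords.
rewrite !(linearB, linearZ) /= !hX ?EY //; try lia.
by_coords.
Qed.
End Equitable.

(** * Compatibility in terms of diagonal operators *)

Section Assembly.
Variables (F : fieldType) (V : vectType F) (N : nat).
Variable B : Delta N -> {vspace V}.
Hypothesis hB : billiard_array B.
Variable w : nat -> nat -> nat -> V.
Hypothesis wB : forall r s t l,
  coords l = (r, s, t) -> w r s t \in B l /\ w r s t != 0.

Lemma edge_bases (hV : \dim (fullv : {vspace V}) = N.+1) :
  [/\ edge_basis N w, edge_basis N (rot w) & edge_basis N (rot (rot w))].
Proof.
have h1 (i : 'I_N.+1) : (0 + i + (N - i) = N)%N by have := ltn_ord i; lia.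
have h2 (i : 'I_N.+1) : (N - i + 0 + i = N)%N by have := ltn_ord i; lia.
have h3 (i : 'I_N.+1) : (i + (N - i) + 0 = N)%N by have := ltn_ord i; lia.
have L1 : is_line [set l : Delta N | (coords l).1.1 == 0%N].
  by exists 0%N; split=> //; constructor 1.
have L2 : is_line [set l : Delta N | (coords l).1.2 == 0%N].
  by exists 0%N; split=> //; constructor 2.
have L3 : is_line [set l : Delta N | (coords l).2 == 0%N].
  by exists 0%N; split=> //; constructor 3.
split.
- apply: (line_basis hB hV (l := fun i => loc (h1 i)) L1) => [i j|i|i].
  + by move=> /(congr1 (@coords N)); rewrite !coords_loc => -[/val_inj].
  + by rewrite inE coords_loc.
  + exact: wB (coords_loc (h1 i)).
- apply: (line_basis hB hV (l := fun i => loc (h2 i)) L2) => [i j|i|i].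
  + by move=> /(congr1 (@coords N)); rewrite !coords_loc => -[_ /val_inj].
  + by rewrite inE coords_loc.
  + exact: wB (coords_loc (h2 i)).
- apply: (line_basis hB hV (l := fun i => loc (h3 i)) L3) => [i j|i|i].
  + by move=> /(congr1 (@coords N)); rewrite !coords_loc => -[/val_inj].
  + by rewrite inE coords_loc.
  + exact: wB (coords_loc (h3 i)).
Qed.

Lemma eigen_component (f : 'End(V)) (c : F) r s t (h : (r + s + t = N)%N) :
  (forall v, v \in B (loc h) -> (f - c *: \1)%VF v = 0) <->
  f (w r s t) = c *: w r s t.
Proof.
have [wm w0] := wB (coords_loc h).
have subE v : (f - c *: \1)%VF v = f v - c *: v.
  by rewrite add_lfunE opp_lfunE scale_lfunE id_lfunE.
split=> [/(_ _ wm)/eqP|E v hv]; first by rewrite subE subr_eq0 => /eqP.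
have /vlineP[k ->] : v \in <[w r s t]>%VS.
  suff -> : <[w r s t]>%VS = B (loc h) by [].
  apply/eqP; rewrite eqEdim -memvE wm dim_vline w0.
  by case: hB => ->.
by rewrite subE linearZ /= E !scalerA mulrC subrr.
Qed.

(** The decompositions [2,3], [3,1], [1,2] run along the edges r = 0, s = 0,
    t = 0, and component i has eigenvalue 2i - N = i - (N - i). *)
Lemma compatibleP (rho : 'Hom(sl2 F, 'End(V))) :
  is_compatible B rho <->
  [/\ edge_diagonal N w (rho (sl2x F)), edge_diagonal N (rot w) (rho (sl2y F))
    & edge_diagonal N (rot (rot w)) (rho (sl2z F))].
Proof.
have cE (i : 'I_N.+1) :
    (2 * i)%N%:R - N%:R = i%:R - (N - i)%:R :> F.
  by rewrite natrB -1?ltnS // natrM; ring.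
split=> [H|[HX HY HZ] i].
  have E s t : (s + t = N)%N -> exists2 i : 'I_N.+1, s = (N - i)%N & t = i.
    move=> st; have tN : (t < N.+1)%N by lia.
    by exists (Ordinal tN) => //=; lia.
  by split=> s t /E[i -> ->]; rewrite -cE; have [Hx Hy Hz] := H i;
    [move: Hx | move: Hy | move: Hz] => /eigen_component.
have iN : (N - i + i = N)%N by rewrite subnK // -ltnS.
by split; apply/eigen_component; rewrite cE; [apply: HX | apply: HY | apply: HZ].
Qed.
End Assembly.

(** * Representations given by three operators *)

Section Representation.
Variables (F : fieldType) (V : vectType F).

Lemma sl2_hom_ext (rho rho' : 'Hom(sl2 F, 'End(V))) :
  rho (sl2x F) = rho' (sl2x F) -> rho (sl2y F) = rho' (sl2y F) ->
  rho (sl2z F) = rho' (sl2z F) -> rho = rho'.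
Proof.
move=> hx hy hz; apply/lfunP => a; rewrite (row_sum_delta a) !linear_sum.
apply: eq_bigr => j _; rewrite !linearZ; congr (_ *: _).
case: j => -[|[|[|//]]] h.
- by have -> : Ordinal h = 0 by exact: val_inj.
- by have -> : Ordinal h = 1 by exact: val_inj.
- by have -> : Ordinal h = 2 by exact: val_inj.
Qed.

Lemma sl2_module_exists (X Y Z : 'End(V)) :
  (forall v, X (Y v) = Y (X v) + 2%:R *: X v + 2%:R *: Y v) ->
  (forall v, Y (Z v) = Z (Y v) + 2%:R *: Y v + 2%:R *: Z v) ->
  (forall v, Z (X v) = X (Z v) + 2%:R *: Z v + 2%:R *: X v) ->
  exists rho : 'Hom(sl2 F, 'End(V)), is_sl2_module rho /\
    [/\ rho (sl2x F) = X, rho (sl2y F) = Y & rho (sl2z F) = Z].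
Proof.
move=> hXY hYZ hZX.
pose a_ (a : 'rV[F]_3) i := a 0 i.
pose f (a : sl2 F) : 'End(V) := a_ a 0 *: X + a_ a 1 *: Y + a_ a 2 *: Z.
have lin_f : linear f.
  by move=> k a b; rewrite /f /a_ !mxE; by_coords.
pose flM := GRing.isLinear.Build _ _ _ _ f lin_f.
pose fl : {linear sl2 F -> 'End(V)} := HB.pack f flM.
have rE a : linfun fl a = f a by rewrite lfunE.
exists (linfun fl); split=> [a b|].
  have bE : f (sl2_bracket a b) =
      (2%:R * (a_ a 0 * a_ b 1 - a_ a 1 * a_ b 0 + a_ a 2 * a_ b 0
               - a_ a 0 * a_ b 2)) *: X
    + (2%:R * (a_ a 0 * a_ b 1 - a_ a 1 * a_ b 0 + a_ a 1 * a_ b 2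
               - a_ a 2 * a_ b 1)) *: Y
    + (2%:R * (a_ a 1 * a_ b 2 - a_ a 2 * a_ b 1 + a_ a 2 * a_ b 0
               - a_ a 0 * a_ b 2)) *: Z.
    by rewrite /f /a_ !mxE /=; congr (_ *: _ + _ *: _ + _ *: _); ring.
  apply/lfunP => v; rewrite !rE add_lfunE opp_lfunE !comp_lfunE bE /f.
  (* Abstracting the entries and the vectors keeps the final ring identities
     small. *)
  move: (a_ a 0) (a_ a 1) (a_ a 2) (a_ b 0) (a_ b 1) (a_ b 2).
  move=> a0 a1 a2 c0 c1 c2; rewrite !(add_lfunE, scale_lfunE).
  rewrite !linearD !linearZ /= hXY hYZ hZX.
  move: (X v) (Y v) (Z v) (X (X v)) (Y (X v)) (X (Z v)) (Y (Y v)) (Z (Y v)).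
  by move=> *; by_coords.
rewrite !rE /f /a_ !mxE /=.
by split; rewrite !(scale1r, scale0r, addr0, add0r).
Qed.
End Representation.

Lemma small_natr_neq0 (F : fieldType) (N : nat) :
  [pchar F] =i pred0 \/ (exists2 p, p \in [pchar F] & (N < p)%N) ->
  forall k, (0 < k <= N)%N -> k%:R != 0 :> F.
Proof.
move=> hF k /andP[k0 kN]; case: hF => [/pcharf0P ->|[p hp Np]].
  by rewrite -lt0n.
by rewrite -(dvdn_pcharf hp) gtnNdvd // (leq_ltn_trans kN).
Qed.

Theorem theorem21p10 (F : fieldType) (hF : 2%N \notin [pchar F])
    (N : nat) (V : vectType F) (hV : \dim (fullv : {vspace V}) = N.+1)
    (B : Delta N -> {vspace V}) (hB : billiard_array B)
    (hw : forall la mu nu : Delta N,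
        white_clique la mu nu -> is_Bvalue B la mu nu 1) :
  (exists! rho : 'Hom(sl2 F, 'End(V)),
     is_sl2_module rho /\ is_compatible B rho) /\
  (forall rho : 'Hom(sl2 F, 'End(V)),
     is_sl2_module rho -> is_compatible B rho ->
     [pchar F] =i pred0 \/ (exists2 p, p \in [pchar F] & (N < p)%N) ->
     sl2_irreducible rho).
Proof.
have [w [bal wB]] := frame_exists hB hw.
have bal1 := balanced_rot bal; have bal2 := balanced_rot bal1.
have [b0 b1 b2] := edge_bases hB wB hV.
split.
  have [X hX] := edge_diagonal_exists b0.
  have [Y hY] := edge_diagonal_exists b1.
  have [Z hZ] := edge_diagonal_exists b2.
  have [rho [hrho [rx ry rz]]] := sl2_module_exists
    (equitable_bracket bal b0 hX hY) (equitable_bracket bal1 b1 hY hZ)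
    (equitable_bracket bal2 b2 hZ hX).
  exists rho; split.
    by split=> //; apply/(compatibleP hB wB); rewrite rx ry rz.
  move=> rho' [_ /(compatibleP hB wB)[hX' hY' hZ']].
  apply: sl2_hom_ext; rewrite ?rx ?ry ?rz.
  - by apply: (edge_ext b0) => s t st; rewrite hX ?hX'.
  - by apply: (edge_ext b1) => s t st; rewrite hY ?hY'.
  - by apply: (edge_ext b2) => s t st; rewrite hZ ?hZ'.
move=> rho hrho /(compatibleP hB wB)[hX hY hZ] char.
split; first by move=> V0; move: hV; rewrite V0 dimv0.
have two : 2%:R != 0 :> F by apply: contra hF => h; rewrite inE /= h.
have nz k : (0 < k <= N)%N -> (2 * k)%:R != 0 :> F.
  by move=> hk; rewrite natrM mulf_neq0 // (small_natr_neq0 char).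
move=> W hW.
have subD a b : ((rho a + rho b)%R @: W <= W)%VS.
  apply/subvP => _ /memv_imgP[v vW ->]; rewrite add_lfunE.
  by apply: memvD; apply: (subvP (hW _)); apply: memv_img.
pose f i := w 0%N i (N - i)%N.
have R0 : (rho (sl2x F) + rho (sl2y F)) (f 0%N) = 0.
  by rewrite /f subn0 (raise_edge bal hX hY) // muln0 scale0r.
have hR i : (i < N)%N -> (rho (sl2x F) + rho (sl2y F)) (f i.+1)
    = (2 * i.+1)%:R *: f i /\ (2 * i.+1)%:R != 0 :> F.
  move=> iN; split; last exact: nz.
  rewrite /f (raise_edge bal hX hY); last lia.
  by rewrite -[in RHS](@subnSK i N).
have hL i : (i < N)%N -> (rho (sl2x F) + rho (sl2z F)) (f i)
    = - (2 * (N - i))%:R *: f i.+1 /\ - (2 * (N - i))%:R != 0 :> F.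
  move=> iN; split; last by rewrite oppr_eq0 nz //; lia.
  rewrite /f (lower_edge bal hX hZ); last lia.
  by rewrite subnS.
exact: (@ladder_irreducible _ _ N f _ _ (fun i => (2 * i.+1)%:R)
  (fun i => - (2 * (N - i))%:R) _ b0 R0 hR hL (subD _ _) (subD _ _)).
Qed.
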